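(* Let $n \geq 1$ be an integer, let $X$ be the random walk on the $n$-path with state space $\{0,1,\ldots,n\}$, and let $\mu,\nu$ be probability distributions on $\{0,\ldots,n\}$. Then the optimal transport time $H(\mu,\nu)$ from $\mu$ to $\nu$ using $X$ satisfies $$H(\mu,\nu) = \mathbb{E}_{Z\sim\nu}[Z^2] - \mathbb{E}_{Z\sim\mu}[Z^2] + 2n \max_{j\in\{0,\ldots,n\}} \Big(\mathbb{E}_{Z\sim\mu}\big[(Z-j)_+\big] - \mathbb{E}_{Z\sim\nu}\big[(Z-j)_+\big]\Big).$$ In particular, $$\Big(\mathbb{E}_{Z\sim\nu}[Z^2] - \mathbb{E}_{Z\sim\mu}[Z^2] + 2n\big(\mathbb{E}_{Z\sim\mu}[Z] - \mathbb{E}_{Z\sim\nu}[Z]\big)\Big)_+ \leq H(\mu,\nu) \leq n^2 = O(n^2).$$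
   Context: The random walk on the $n$-path is the discrete-time Markov chain on $\{0,\ldots,n\}$ with $p_{i,i\pm1} = 1/2$ for $1 \leq i \leq n-1$, $p_{0,1} = 1$, $p_{n,n-1} = 1$, and $p_{i,j} = 0$ otherwise. For probability distributions $\mu,\nu$ on the state space, the optimal transport time (also called access time) is $H(\mu,\nu) := \inf_{T} \mathbb{E}[T]$, where $X_0 \sim \mu$ and the infimum is over all almost surely finite, possibly randomized, stopping times $T$ of $X$ such that $X_T \sim \nu$. (A randomized stopping time is a stopping time with respect to a filtration $\mathcal{F}_t = \sigma(U, X_0,\dots,X_t)$, where $U$ is uniform on $[0,1]$ and independent of $X$.) $\mathbb{E}_{Z\sim\mu}$ denotes expectation when $Z$ has law $\mu$, and $x_+ := \max\{x,0\}$. *)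

(* Defs.v *)
From HB Require Import structures.
From mathcomp Require Import all_boot all_order all_algebra.
From mathcomp Require Import all_classical all_reals all_analysis.

Set Implicit Arguments.
Unset Strict Implicit.
Unset Printing Implicit Defensive.

Import Order.TTheory GRing.Theory Num.Theory.
Import numFieldNormedType.Exports.

Local Open Scope classical_set_scope.
Local Open Scope ring_scope.

(* The finite state space {0, ..., n} with its discrete sigma-algebra, so that
   [probability 'I_n.+1 R] is the type of distributions on {0, ..., n} and
   ['E_mu[f]] is the expectation of f(Z) for Z of law mu. *)
HB.instance Definition _ (n : nat) := isPointed.Build 'I_n.+1 ord0.
HB.instance Definition _ (n : nat) := @isMeasurable.Build
  default_measure_display 'I_n.+1 discrete_measurable discrete_measurable0
  discrete_measurableC discrete_measurableU.

Definition path_walk (R : realType) (n : nat) (i j : 'I_n.+1) : R :=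
  if (0 < i < n)%N then
    if ((j == i.+1 :> nat) || (i == j.+1 :> nat))%N then 2^-1 else 0
  else if ((i == 0 :> nat) && (j == 1 :> nat))%N then 1
  else if ((i == n :> nat) && (n == j.+1 :> nat))%N then 1
  else 0.

Section Process.
Context (R : realType) (n : nat) (d : measure_display) (Omega : measurableType d)
  (P : probability Omega R).
Implicit Types (U : {RV P >-> R}) (X : nat -> {RV P >-> 'I_n.+1}).

(* [markov_step] is P(X_{t+1} = j | X_0 = x_0, ..., X_t = x_t) = p(x_t, j),
   multiplied out so that conditioning on a null event imposes nothing. *)
Record markov_chain (p : 'I_n.+1 -> 'I_n.+1 -> R) (mu : probability 'I_n.+1 R)
    X : Prop := {
  markov_init : forall A : set 'I_n.+1, distribution P (X 0%N) A = mu A;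
  markov_step : forall (t : nat) (x : nat -> 'I_n.+1) (j : 'I_n.+1),
    P ([set w | forall s : nat, (s <= t)%N -> X s w = x s]
         `&` X t.+1 @^-1` [set j]) =
    ((p (x t) j)%:E * P [set w | forall s : nat, (s <= t)%N -> X s w = x s])%E
}.

Definition uniform01 U : Prop :=
  forall A : set R, measurable A ->
    distribution P U A = uniform_prob (@ltr01 R) A.

Definition independent_of_process U X : Prop :=
  forall A B : set Omega,
    g_sigma_algebra_preimage U A ->
    <<s \bigcup_t g_sigma_algebra_preimage (X t) >> B ->
    P (A `&` B) = (P A * P B)%E.

Definition filtration U X (t : nat) : set (set Omega) :=
  <<s g_sigma_algebra_preimage U
      `|` \bigcup_(s in [set s | (s <= t)%N]) g_sigma_algebra_preimage (X s) >>.

(* A random time takes values in nat extended with infinity, encoded as [None]. *)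
Definition stopping_time U X (T : Omega -> option nat) : Prop :=
  forall t : nat,
    filtration U X t [set w | exists2 s : nat, (s <= t)%N & T w = Some s].

Definition time_val (o : option nat) : \bar R :=
  if o is Some t then (t%:R)%:E else +oo%E.

Record transports U X (nu : probability 'I_n.+1 R) (T : Omega -> option nat)
    : Prop := {
  transports_stopping : stopping_time U X T;
  transports_finite : {ae P, forall w, T w <> None};
  transports_law : forall A : set 'I_n.+1,
    P [set w | exists2 t : nat, T w = Some t & A (X t w)] = nu A
}.

Definition transport_time U X (nu : probability 'I_n.+1 R) : \bar R :=
  ereal_inf [set (\int[P]_w time_val (T w))%E | T in transports U X nu].

End Process.

(* Main.v *)
Require Import Defs.
From HB Require Import structures.
From mathcomp Require Import all_boot all_order all_algebra.
From mathcomp Require Import all_classical all_reals all_analysis.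
From mathcomp Require Import measurable_realfun ring lra zify.

Set Implicit Arguments.
Unset Strict Implicit.
Unset Printing Implicit Defensive.

Import Order.TTheory GRing.Theory Num.Theory.
Import numFieldNormedType.Exports.

Local Open Scope classical_set_scope.
Local Open Scope ring_scope.

(** The mean time that the walk on the path needs from [z] to [j] is
    [j ^ 2 - h_j z], where [h_j z = z ^ 2 - 2 n (z - j)_+]. The expression in the
    theorem is therefore the largest, over the targets [j], of the differences
      E_mu [time to reach j] - E_nu [time to reach j] = E_nu [h_j] - E_mu [h_j],
    called [hitting_gap] below, and the theorem says that the transport time is
    the worst such gap.

    The function [h_j] has drift [1] off [j], and [1 - w] at [j], where [w] is the
    mean return time to [j] ([potential_laplacian]). Dynkin's formula up to a
    stopping time that leads from [mu] to [nu] hence reads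
      E [T] = hitting gap of j + w * E [number of visits to j before T]
    ([flow_time], in a form truncated at time [t] to avoid integrability
    questions). Visits are nonnegative, so every gap bounds E [T] from below, and
    the bound for [j] is sharp when the walk always stops on reaching [j].

    Such a stopping time exists. The filling rule stops, at each time and state,
    as much of the arriving mass as the target still admits; the state filled
    last is never left ([filling_halting_state]). As hitting times on the path
    are at most [n ^ 2], so is the time spent, hence all mass is eventually stopped
    and the target is filled ([cvg_filling_stop]).

    These arguments concern only the masses that stop, or go on, at each time in
    each state; such a pair of families is a [stopping_flow]. Stopping times and
    flows correspond to each other. A stopping time for the filtration of [U] and
    the walk induces a flow because the Markov property extends to that
    filtration ([markov_filtration], [stopping_time_flow]). Conversely, a flow is
    realized by stopping as soon as [U] is no longer below the product of the
    conditional probabilities of going on along the path visited so far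
    ([realizing_time_go], [realizing_time_stop]). *)

(** * The walk on the path and the hitting-time potential *)

(** Up to sign and a constant this is a hitting time: the walk started at [z]
    needs [j ^ 2 - potential n j z] steps on average to reach [j]. *)
Definition potential (R : realType) (n j z : nat) : R :=
  z%:R ^+ 2 - 2 * n%:R * Num.max (z%:R - j%:R) 0.

(** The mean return time to [j], i.e. the inverse of the stationary mass. *)
Definition return_time (R : realType) (n j : nat) : R :=
  if (0 < j < n)%N then n%:R else 2 * n%:R.

Section PathWalk.
Context {R : realType} {n : nat} (n_gt0 : (0 < n)%N).
Implicit Types (x y j : 'I_n.+1).
Local Notation p := (@path_walk R n).

Let sum_indicator (f : nat -> R) (k : nat) : (k <= n)%N ->
  \sum_(y < n.+1) (y == k :> nat)%:R * f y = f k.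
Proof.
rewrite -ltnS => kn; rewrite (bigD1 (Ordinal kn))//= eqxx mul1r big1 ?addr0//.
by move=> y; rewrite -val_eqE/= => /negbTE ->; rewrite mul0r.
Qed.

Lemma path_walk_mean (f : nat -> R) x :
  \sum_y p x y * f y = if x == 0 :> nat then f 1%N
                       else if x == n :> nat then f n.-1
                       else (f x.+1 + f x.-1) / 2.
Proof.
have xn : (x <= n)%N by rewrite -ltnS ltn_ord.
case: (eqVneq (x : nat) 0%N) => [x0|x0].
  rewrite -(sum_indicator f (k := 1))//; apply: eq_bigr => y _.
  rewrite /path_walk x0/=; case: eqP => //= _.
  by rewrite ltn_eqF.
case: (eqVneq (x : nat) n) => [xEn|xNn].
  rewrite -(sum_indicator f (k := n.-1)) ?leq_pred//; apply: eq_bigr => y _.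
  rewrite /path_walk xEn ltnn andbF/= eqxx/=.
  have -> : (n == 0)%N = false by lia.
  have -> : (n == y.+1)%N = (y == n.-1 :> nat) by lia.
  by case: ifP.
rewrite -(sum_indicator f (k := x.+1)); last lia.
rewrite -(sum_indicator f (k := x.-1)); last lia.
rewrite -big_split/= mulr_suml; apply: eq_bigr => y _.
rewrite /path_walk (_ : (0 < x < n)%N = true); last lia.
have -> : (x == y.+1 :> nat) = (y == x.-1 :> nat) by lia.
case: (eqVneq (y : nat) x.+1) => [yx|_].
  by rewrite (_ : (y == x.-1 :> nat) = false)/=; [field|lia].
by case: eqP => _ /=; field.
Qed.

Lemma path_walk_ge0 x y : 0 <= p x y.
Proof. by rewrite /path_walk; do ![case: ifP => _ //]; rewrite invr_ge0. Qed.

Lemma path_walk_stochastic x : \sum_y p x y = 1.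
Proof.
under eq_bigr do rewrite -[p _ _]mulr1.
rewrite (path_walk_mean (fun=> 1)).
by do ![case: ifP => _ //]; field.
Qed.

Lemma return_time_ge0 (j : nat) : 0 <= return_time R n j.
Proof. by rewrite /return_time; case: ifP => _; rewrite ?mulr_ge0. Qed.

Let pos_part (a b : nat) :
  Num.max (a%:R - b%:R : R) 0 = (a - b)%:R.
Proof.
have [ab|/ltnW ab] := leqP a b.
  by rewrite (eqP ab); apply/max_idPr; rewrite subr_le0 ler_nat.
by rewrite natrB//; apply/max_idPl; rewrite subr_ge0 ler_nat.
Qed.

(** Away from [j], one step lowers the mean hitting time of [j] by exactly one;
    at [j] itself the drift is corrected by the mean return time. This single
    test function replaces solving for the occupation measure of a stopping
    time: it exposes both the total time and the visits to [j]. *)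
Lemma potential_laplacian j x :
  \sum_y p x y * potential R n j y - potential R n j x =
  1 - return_time R n j * (x == j)%:R.
Proof.
rewrite (path_walk_mean (potential R n j)) /potential /return_time !pos_part.
have xn : (x <= n)%N by rewrite -ltnS ltn_ord.
have jn : (j <= n)%N by rewrite -ltnS ltn_ord.
have -> : (x == j) = (x == j :> nat) by [].
move: (x : nat) (j : nat) xn jn => {}x {}j xn jn.
case: (eqVneq x 0%N) => [->|x0].
  rewrite sub0n; case: (eqVneq j 0%N) => [->|j0].
    by rewrite /= subn0; ring.
  rewrite (_ : (1 - j)%N = 0%N); last lia.
  by rewrite /=; ring.
have nE : n%:R = n.-1%:R + 1 :> R by rewrite natr1 prednK.
case: (eqVneq x n) => [->|xNn].
  case: (eqVneq n j) => [<-|jNn].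
    rewrite subnn ltnn andbF (_ : (n.-1 - n)%N = 0%N); last lia.
    by rewrite /= nE; ring.
  rewrite (_ : (n - j)%N = (n.-1 - j).+1); last lia.
  by rewrite -natr1 nE /=; ring.
have {x0} [k xk] : exists k, x = k.+1 by exists x.-1; lia.
subst x.
have k1 : k.+1%:R = k%:R + 1 :> R by rewrite natr1.
have k2 : k.+2%:R = k%:R + 2 :> R by rewrite -natrD addn2.
rewrite /= k1 k2; case: (ltngtP k.+1 j) => [kj|jk|<-].
- rewrite (_ : (k.+2 - j)%N = 0%N); last lia.
  rewrite (_ : (k - j)%N = 0%N); last lia.
  rewrite (_ : (k.+1 - j)%N = 0%N); last lia.
  by rewrite /= !mulr0; field.
- rewrite (_ : (k.+2 - j)%N = (k - j).+2); last lia.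
  rewrite (_ : (k.+1 - j)%N = (k - j).+1); last lia.
  by rewrite -[(k - j).+2%:R]natr1 -[(k - j).+1%:R]natr1 /= mulr0; field.
- rewrite (_ : (k.+2 - k.+1)%N = 1%N); last lia.
  rewrite (_ : (k - k.+1)%N = 0%N); last lia.
  rewrite subnn (_ : (0 < k.+1 < n)%N = true); last lia.
  by rewrite /=; field.
Qed.

(** Hitting times on the path lie between [0] and [n ^ 2], the time needed to
    cross it, so they differ by at most that. *)
Lemma potential_spread j x y :
  potential R n j x - potential R n j y <= n%:R ^+ 2.
Proof.
rewrite /potential !pos_part.
have xn : (x <= n)%N by rewrite -ltnS ltn_ord.
have yn : (y <= n)%N by rewrite -ltnS ltn_ord.
have jn : (j <= n)%N by rewrite -ltnS ltn_ord.
move: (x : nat) (j : nat) (y : nat) xn jn yn => {}x {}j {}y.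
rewrite -!(ler_nat R) => xn jn yn.
have x0 := ler0n R x; have y0 := ler0n R y; have j0 := ler0n R j.
have [xj|/ltnW xj] := leqP x j; have [yj|/ltnW yj] := leqP y j.
- rewrite (eqP xj) (eqP yj); nra.
- rewrite (eqP xj) natrB//; move: xj yj; rewrite -!(ler_nat R) => xj yj.
  have : x%:R ^+ 2 <= j%:R ^+ 2 :> R by nra.
  nra.
- rewrite (eqP yj) natrB//; move: xj yj; rewrite -!(ler_nat R) => xj yj.
  have : (n%:R - x%:R) ^+ 2 <= (n%:R - j%:R) ^+ 2 :> R by nra.
  nra.
- rewrite !natrB//; move: xj yj; rewrite -!(ler_nat R) => xj yj.
  have : (n%:R - x%:R) ^+ 2 <= n%:R ^+ 2 :> R by nra.
  nra.
Qed.

End PathWalk.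

(** * Stopping flows *)

(** The trace that a randomized stopping time leaves on the laws: [m t x] is the
    mass stopped at time [t] in state [x], [g t x] the mass that goes on from
    [x] at time [t]. All the optimization takes place on such flows. *)
Record stopping_flow (R : realType) (n : nat) (p : 'I_n.+1 -> 'I_n.+1 -> R)
    (mu : 'I_n.+1 -> R) (m g : nat -> 'I_n.+1 -> R) : Prop := {
  flow_stop_ge0 : forall t x, 0 <= m t x;
  flow_go_ge0 : forall t x, 0 <= g t x;
  flow_init : forall x, m 0%N x + g 0%N x = mu x;
  flow_step : forall t y, m t.+1 y + g t.+1 y = \sum_x g t x * p x y
}.

Section Flow.
Context {R : realType} {n : nat} (n_gt0 : (0 < n)%N).
Implicit Types (x y j : 'I_n.+1) (mu nu : 'I_n.+1 -> R)
  (m g : nat -> 'I_n.+1 -> R).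
Local Notation p := (@path_walk R n).

(** The law of the walk at the minimum of [t] and the stopping time. *)
Definition stopped_law m g t x : R := \sum_(s < t.+1) m s x + g t x.

(** The mean time to reach [j] from [mu], minus that from [nu]: the constant in
    the hitting time cancels when both have the same mass. *)
Definition hitting_gap mu nu j : R :=
  \sum_(x < n.+1) potential R n j x * (nu x - mu x).

Section Theory.
Variables (mu : 'I_n.+1 -> R) (m g : nat -> 'I_n.+1 -> R).
Hypothesis mgF : stopping_flow p mu m g.

Lemma stopped_law_ge0 t x : 0 <= stopped_law m g t x.
Proof.
rewrite addr_ge0 ?(flow_go_ge0 mgF)// sumr_ge0// => s _.
exact: flow_stop_ge0 mgF _ _.
Qed.

(** Dynkin's formula for the stopped walk: the mean of [f] changes by the
    accumulated drift of [f] over the mass that is still moving. *)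
Lemma flow_dynkin (f : 'I_n.+1 -> R) t :
  \sum_x f x * stopped_law m g t x =
  \sum_x f x * mu x
  + \sum_(s < t) \sum_x (\sum_y p x y * f y - f x) * g s x.
Proof.
elim: t => [|t IHt].
  rewrite big_ord0 addr0; apply: eq_bigr => x _.
  by rewrite /stopped_law big_ord1 (flow_init mgF).
rewrite [X in _ = _ + X]big_ord_recr/= addrA -IHt; apply/eqP.
rewrite addrC -subr_eq -sumrB; apply/eqP.
transitivity (\sum_x f x * (\sum_y g t y * p y x - g t x)).
  apply: eq_bigr => x _; rewrite -(flow_step mgF) /stopped_law big_ord_recr/=.
  by ring.
under [LHS]eq_bigr do rewrite mulrBr; rewrite sumrB.
under [RHS]eq_bigr do rewrite mulrBl; rewrite sumrB; congr (_ - _).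
under [LHS]eq_bigr do rewrite mulr_sumr.
rewrite exchange_big; apply: eq_bigr => x _; rewrite mulr_suml.
by apply: eq_bigr => y _; ring.
Qed.

Lemma flow_mass t : \sum_x stopped_law m g t x = \sum_x mu x.
Proof.
have := flow_dynkin (fun=> 1) t.
under eq_bigr do rewrite mul1r; move=> ->.
under eq_bigr do rewrite mul1r.
rewrite [X in _ + X]big1 ?addr0// => s _; rewrite big1// => x _.
by under eq_bigr do rewrite mulr1; rewrite path_walk_stochastic// subrr mul0r.
Qed.

(** Dynkin's formula for the potential of [j]. The visits to [j] before stopping,
    each counted with the return time, make up the whole excess of the elapsed
    time over the hitting-time gap; so the gap is always a lower bound, reached
    if [j] is never left. *)
Lemma flow_time j t :
  \sum_(s < t) \sum_x g s x =
  hitting_gap mu (stopped_law m g t) j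
  + return_time R n j * \sum_(s < t) g s j.
Proof.
rewrite /hitting_gap; under [X in _ = X + _]eq_bigr do rewrite mulrBr.
rewrite sumrB flow_dynkin [X in _ = X + _]addrAC subrr add0r mulr_sumr.
rewrite -big_split/=.
apply: eq_bigr => s _; under [X in _ = X + _]eq_bigr do
  rewrite potential_laplacian// mulrBl mul1r.
rewrite sumrB.
have -> : \sum_(x < n.+1) return_time R n j * (x == j)%:R * g s x
    = return_time R n j * g s j.
  rewrite (bigD1 j)//= eqxx mulr1 big1 ?addr0// => x /negbTE ->.
  by rewrite mulr0 mul0r.
by rewrite subrK.
Qed.

(** Couple the two laws independently and compare potentials pairwise. *)
Lemma hitting_gap_le nu j : (forall x, 0 <= mu x) -> (forall x, 0 <= nu x) ->
  \sum_x mu x = 1 -> \sum_x nu x = 1 -> hitting_gap mu nu j <= n%:R ^+ 2.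
Proof.
move=> mu0 nu0 mu1 nu1.
rewrite /hitting_gap; under eq_bigr do rewrite mulrBr; rewrite sumrB.
have -> : \sum_(x < n.+1) potential R n j x * nu x =
    \sum_(x < n.+1) \sum_(y < n.+1) potential R n j x * (nu x * mu y).
  by apply: eq_bigr => x _; rewrite -mulr_sumr -mulr_sumr mu1 mulr1.
have -> : \sum_(y < n.+1) potential R n j y * mu y =
    \sum_(x < n.+1) \sum_(y < n.+1) potential R n j y * (nu x * mu y).
  rewrite exchange_big; apply: eq_bigr => y _.
  by rewrite -mulr_sumr -mulr_suml nu1 mul1r.
rewrite -sumrB.
apply: (@le_trans _ _ (\sum_x \sum_y n%:R ^+ 2 * (nu x * mu y))).
  apply: ler_sum => x _; rewrite -sumrB; apply: ler_sum => y _.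
  by rewrite -mulrBl ler_wpM2r ?mulr_ge0// potential_spread.
under eq_bigr do rewrite -mulr_sumr -mulr_sumr mu1 mulr1.
by rewrite -mulr_sumr nu1 mulr1.
Qed.

Lemma cvg_hitting_gap (L : nat -> 'I_n.+1 -> R) nu j :
  (forall x, L ^~ x @ \oo --> nu x) ->
  (fun t => hitting_gap mu (L t) j) @ \oo --> hitting_gap mu nu j.
Proof.
move=> Lnu; apply: cvg_big; first exact: add_continuous.
by move=> x _; apply: cvgMl_tmp; apply: cvgB => //; exact: cvg_cst.
Qed.

End Theory.
End Flow.

Section FlowBounds.
Context {R : realType} {n : nat} (n_gt0 : (0 < n)%N).
Implicit Types (x y j : 'I_n.+1) (mu nu : 'I_n.+1 -> R)
  (m g : nat -> 'I_n.+1 -> R).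
Local Notation p := (@path_walk R n).

(** If everything is eventually stopped, the mass still moving vanishes, since
    the total mass is conserved. *)
Lemma cvg_stopped_law mu nu m g : stopping_flow p mu m g ->
  \sum_x mu x = \sum_x nu x ->
  (forall x, \sum_(s < t.+1) m s x @[t --> \oo] --> nu x) ->
  forall x, stopped_law m g t x @[t --> \oo] --> nu x.
Proof.
move=> mgF munu mnu x; rewrite -[nu x]addr0; apply: cvgD => //.
apply: (@squeeze_cvgr _ _ _ _ (fun=> 0)
  (fun t => \sum_y nu y - \sum_y \sum_(s < t.+1) m s y)).
- near=> t; rewrite (flow_go_ge0 mgF) -munu -(flow_mass n_gt0 mgF t) -sumrB.
  under eq_bigr do rewrite /stopped_law addrAC subrr add0r.
  by rewrite (bigD1 x)//= lerDl sumr_ge0// => y _; exact: flow_go_ge0 mgF _ _.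
- exact: cvg_cst.
- rewrite -[X in _ --> X](subrr (\sum_y nu y)).
  apply: cvgB; first exact: cvg_cst.
  by apply: cvg_big; first exact: add_continuous.
Unshelve. all: by end_near. Qed.

(** The lower bound: drop the nonnegative visits to [j] and let time grow. *)
Lemma hitting_gap_le_flow_time mu nu m g (B : R) : stopping_flow p mu m g ->
  \sum_x mu x = \sum_x nu x ->
  (forall x, \sum_(s < t.+1) m s x @[t --> \oo] --> nu x) ->
  (forall t, \sum_(s < t) \sum_x g s x <= B) ->
  forall j, hitting_gap mu nu j <= B.
Proof.
move=> mgF munu mnu gB j.
have gapj := @cvg_hitting_gap _ _ mu _ _ j (cvg_stopped_law mgF munu mnu).
apply: ler_cvg_to gapj (cvg_cst B) _; near=> t.
apply: le_trans (gB t).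
rewrite (flow_time n_gt0 mgF j) lerDl mulr_ge0 ?return_time_ge0//.
by apply: sumr_ge0 => s _; exact: flow_go_ge0 mgF _ _.
Unshelve. all: by end_near. Qed.

Variables mu nu : 'I_n.+1 -> R.
Hypotheses (mu_ge0 : forall x, 0 <= mu x) (nu_ge0 : forall x, 0 <= nu x).
Hypotheses (mu_sum1 : \sum_x mu x = 1) (nu_sum1 : \sum_x nu x = 1).

(** The filling rule: stop as much of the arriving mass as the target [nu] still
    admits. The first component is the mass present at time [t], the second the
    part of [nu] not yet filled. *)
Fixpoint filling t : ('I_n.+1 -> R) * ('I_n.+1 -> R) :=
  if t is s.+1 then
    let: (a, r) := filling s in
    (fun y => \sum_x (a x - Num.min (a x) (r x)) * path_walk R x y,
     fun x => r x - Num.min (a x) (r x))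
  else (mu, nu).

Let a t x := (filling t).1 x.
Let r t x := (filling t).2 x.

Definition filling_stop t x : R :=
  Num.min ((filling t).1 x) ((filling t).2 x).
Definition filling_go t x : R := (filling t).1 x - filling_stop t x.

Local Notation m := filling_stop.
Local Notation g := filling_go.

Let aS t y : a t.+1 y = \sum_x g t x * path_walk R x y.
Proof. by rewrite /g /m /a/=; case: (filling t). Qed.

Let rS t x : r t.+1 x = r t x - m t x.
Proof. by rewrite /m /r/=; case: (filling t). Qed.

Let go_ge0 t x : 0 <= g t x.
Proof. by rewrite subr_ge0 ge_min lexx. Qed.

Let a_ge0 t x : 0 <= a t x.
Proof.
case: t => [|t]; first exact: mu_ge0.
by rewrite aS sumr_ge0// => y _; rewrite mulr_ge0 ?path_walk_ge0.
Qed.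

Let r_ge0 t x : 0 <= r t x.
Proof.
case: t => [|t]; first exact: nu_ge0.
by rewrite rS subr_ge0 ge_min lexx orbT.
Qed.

Lemma filling_flow : stopping_flow p mu m g.
Proof.
split => //.
- by move=> t x; rewrite /m le_min a_ge0 r_ge0.
- by move=> x; rewrite /g addrC subrK.
- by move=> t y; rewrite -aS /g addrC subrK.
Qed.

Let rE t x : r t x = nu x - \sum_(s < t) m s x.
Proof.
elim: t => [|t IHt]; first by rewrite big_ord0 subr0.
by rewrite rS IHt big_ord_recr/= opprD addrA.
Qed.

Let sum_go t : \sum_x g t x = \sum_x r t.+1 x.
Proof.
under [RHS]eq_bigr do rewrite rE; rewrite [RHS]sumrB nu_sum1 -mu_sum1.
rewrite -(flow_mass n_gt0 filling_flow t) -sumrB; apply: eq_bigr => x _.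
by rewrite /stopped_law addrAC subrr add0r.
Qed.

Let r_nonincreasing x : {homo r^~ x : s t / (s <= t)%N >-> t <= s}.
Proof.
apply: homo_leq => [//|s t u ts us|t]; first exact: le_trans us ts.
by rewrite rS gerBl; exact: flow_stop_ge0 filling_flow _ _.
Qed.

(** A state that is still unfilled has stopped all its arrivals, so it has never
    been left. As long as mass is moving, some state is unfilled; once none is,
    nothing moves and a state found earlier remains valid. *)
Let halting_state_before t : exists j, forall s, (s < t)%N -> g s j = 0.
Proof.
elim: t => [|t [j IHt]]; first by exists ord0.
have [[x rx]|r0] := pselect (exists x, 0 < r t.+1 x).
  exists x => s st; have : 0 < r s.+1 x.
    exact: lt_le_trans rx (r_nonincreasing _ _).
  rewrite rS subr_gt0 {1}/m gt_min ltxx orbF => ar.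
  by rewrite /g /m (min_idPl (ltW ar)) subrr.
exists j => s; rewrite ltnS leq_eqVlt => /predU1P[->|/IHt//].
have /eqP : \sum_x g t x = 0.
  rewrite sum_go big1// => x _; apply/eqP; rewrite eq_le r_ge0 andbT leNgt.
  by apply/negP => rx; apply: r0; exists x.
by rewrite psumr_eq0// => /allP/(_ j); rewrite mem_index_enum => /(_ isT)/eqP.
Qed.

(** The filling rule never leaves some state [j]: candidates valid up to each
    time exist, and there are finitely many states. Such a halting state is the
    classical criterion for a stopping rule to be optimal. *)
Lemma filling_halting_state : exists j, forall t, g t j = 0.
Proof.
apply: contrapT => no_halt.
have /choice[s gs] : forall j, exists s, g s j != 0.
  move=> j; apply: contrapT => gj; apply: no_halt; exists j => t.
  by apply/eqP/negPn/negP => gt0; apply: gj; exists t.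
(* beyond the largest of the times at which the states are left *)
have [j /(_ (s j))] := halting_state_before (\max_j s j).+1.
by rewrite ltnS leq_bigmax => /(_ isT) gsj; have := gs j; rewrite gsj eqxx.
Qed.

Let bounded_by_halting : exists2 j, forall t, g t j = 0 &
  forall t, \sum_(s < t) \sum_x g s x = hitting_gap mu (stopped_law m g t) j.
Proof.
have [j gj] := filling_halting_state; exists j => // t.
by rewrite (flow_time n_gt0 filling_flow j) big1 ?mulr0 ?addr0.
Qed.

(** The time spent is at most [n ^ 2], hence the moving mass is summable and tends
    to zero; it equals the unfilled part of the target. *)
Lemma cvg_filling_stop x : \sum_(s < t.+1) m s x @[t --> \oo] --> nu x.
Proof.
have [j _ gE] := bounded_by_halting.
have gcvg : cvgn (series (fun t => \sum_x g t x)).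
  apply: nondecreasing_is_cvgn.
    by apply: nondecreasing_series => t _ _; exact: sumr_ge0.
  exists (n%:R ^+ 2) => _ [t _ <-]; rewrite seriesEord/= gE.
  apply: hitting_gap_le => //; last by rewrite (flow_mass n_gt0 filling_flow).
  by move=> y; exact: stopped_law_ge0 filling_flow _ _.
apply: (@squeeze_cvgr _ _ _ _ (fun t => nu x - \sum_y g t y) (fun=> nu x)).
- near=> t; rewrite sum_go lerBlDr -subr_ge0 addrAC -lerBlDr sub0r.
  rewrite -opprB lerN2 -rE (bigD1 x)//= lerDl sumr_ge0//=.
  by rewrite -subr_ge0 -rE.
- rewrite -[X in _ --> X]subr0; apply: cvgB; first exact: cvg_cst.
  exact: cvg_series_cvg_0.
- exact: cvg_cst.
Unshelve. all: by end_near. Qed.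

(** At a halting state the excess in [flow_time] disappears; the elapsed time
    increases to its limit, the gap between [mu] and [nu]. *)
Lemma filling_time_le : exists j, forall t,
  \sum_(s < t) \sum_x g s x <= hitting_gap mu nu j.
Proof.
have [j _ gE] := bounded_by_halting; exists j => t.
have gapj : \sum_(s < t) \sum_x g s x @[t --> \oo] --> hitting_gap mu nu j.
  under eq_cvg do rewrite gE.
  apply: cvg_hitting_gap.
  apply: cvg_stopped_law filling_flow _ cvg_filling_stop.
  by rewrite mu_sum1.
rewrite -(cvg_lim _ gapj)//.
apply: nondecreasing_cvgn_le; last exact: cvgP gapj.
apply/nondecreasing_seqP => k; rewrite big_ord_recr/= lerDl.
exact: sumr_ge0.
Qed.

End FlowBounds.

(** * Probabilities on finite partitions *)

Lemma trivIset_set1 (I : choiceType) (D : set I) :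
  trivIset D (fun x => [set x]).
Proof.
apply/trivIsetP => x y _ _ xy; rewrite -subset0 => z [/= zx zy].
by move: xy; rewrite -zx -zy eqxx.
Qed.

Section Partition.
Context {R : realType} {d : measure_display} {Omega : measurableType d}
  (P : probability Omega R).

Lemma probability_partition (I : finType) (Y : Omega -> I) (A : set Omega) :
  (forall i, measurable (Y @^-1` [set i])) -> measurable A ->
  fine (P A) = \sum_i fine (P (A `&` Y @^-1` [set i])).
Proof.
move=> mY mA; rewrite sum_fine; last first.
  by move=> i _; apply: fin_num_measure; apply: measurableI.
congr fine; pose r := index_enum I.
rewrite [in LHS](_ : A = \bigcup_(i in [set` r]) (A `&` Y @^-1` [set i])).
  rewrite measure_fin_bigcup//=.
  - by rewrite -fsbig_seq// index_enum_uniq.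
  - exact: trivIset_preimage1_in.
  - by move=> i _; apply: measurableI.
apply/seteqP; split => [w Aw|w [i _ []]//].
by exists (Y w) => //=; exact: mem_index_enum.
Qed.

End Partition.

Section ExpectationFinite.
Context {R : realType} {n : nat}.

Lemma expectation_ord (mu : probability 'I_n.+1 R) (f : 'I_n.+1 -> R) :
  ('E_mu[f] = (\sum_x f x * fine (mu [set x]))%R%:E)%E.
Proof.
rewrite unlock; pose r := index_enum 'I_n.+1.
have -> : [set: 'I_n.+1] = \big[setU/set0]_(i <- r) [set i].
  apply/esym/seteqP; split => // x _; rewrite -bigcup_seq; exists x => //=.
  exact: mem_index_enum.
rewrite integral_bigsetU_EFin ?index_enum_uniq//; last exact: trivIset_set1.
rewrite -sumEFin; apply: eq_bigr => x _.
rewrite (eq_integral (cst (f x)%:E)); last by move=> y; rewrite inE => ->.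
by rewrite integral_cst// EFinM fineK// fin_num_measure.
Qed.

Lemma sum_probability_ord (mu : probability 'I_n.+1 R) :
  \sum_x fine (mu [set x]) = 1.
Proof.
have -> : 1 = fine (mu setT) by rewrite probability_setT.
rewrite (probability_partition mu (Y := id))//.
by under [RHS]eq_bigr do rewrite setTI.
Qed.
End ExpectationFinite.

(** * The Markov property for randomized stopping times *)

Section Walk.
Context (R : realType) (n : nat) (p : 'I_n.+1 -> 'I_n.+1 -> R)
  (mu : probability 'I_n.+1 R)
  (d : measure_display) (Omega : measurableType d) (P : probability Omega R)
  (U : {RV P >-> R}) (X : nat -> {RV P >-> 'I_n.+1}).
Hypothesis hX : markov_chain p mu X.
Hypothesis hUX : independent_of_process U X.

Local Notation pr A := (fine (P A)).

Definition path_event t (x : nat -> 'I_n.+1) : set Omega :=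
  [set w | forall s, (s <= t)%N -> X s w = x s].

Definition history t (w : Omega) : {ffun 'I_t.+1 -> 'I_n.+1} :=
  [ffun s : 'I_t.+1 => X s w].

(** Extends a history to an infinite path, the form in which paths enter the
    Markov property; the values beyond [t] are arbitrary. *)
Definition path_of t (h : {ffun 'I_t.+1 -> 'I_n.+1}) (s : nat) : 'I_n.+1 :=
  h (inord s).

Lemma preimage_history t h : history t @^-1` [set h] = path_event t (path_of h).
Proof.
apply/seteqP; split => w /=.
  by move=> <- s st; rewrite /path_of ffunE inordK.
move=> wh; apply/ffunP => s; rewrite ffunE wh; last by rewrite -ltnS.
by rewrite /path_of inord_val.
Qed.

Definition process_event : set (set Omega) :=
  <<s \bigcup_t g_sigma_algebra_preimage (X t) >>.

Lemma process_eventX t B : process_event (X t @^-1` B).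
Proof.
by apply: sub_sigma_algebra; exists t => //; exists B => //; rewrite setTI.
Qed.

Lemma sigma_algebra_path_event (G : set (set Omega)) t x :
  (forall s, (s <= t)%N -> <<s G >> (X s @^-1` [set x s])) ->
  <<s G >> (path_event t x).
Proof.
elim: t => [|t IHt] GX.
  rewrite (_ : path_event 0 x = X 0%N @^-1` [set x 0%N]); first exact: GX.
  apply/seteqP; split => w /=; first exact.
  by move=> w0 s; rewrite leqn0 => /eqP ->.
rewrite (_ : path_event t.+1 x = path_event t x `&` X t.+1 @^-1` [set x t.+1]).
  apply: (@measurableI _ (g_sigma_algebraType G)); last exact: GX.
  by apply: IHt => s st; apply: GX; exact: leqW.
apply/seteqP; split => w /=.
  by move=> wx; split => [s st|]; apply: wx => //; exact: leqW.
by move=> [wx wt] s; rewrite leq_eqVlt => /predU1P[->|/wx].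
Qed.

Lemma process_event_path t x : process_event (path_event t x).
Proof. by apply: sigma_algebra_path_event => s _; exact: process_eventX. Qed.

Lemma process_eventI A B :
  process_event A -> process_event B -> process_event (A `&` B).
Proof.
exact: (@measurableI _
  (g_sigma_algebraType (\bigcup_t g_sigma_algebra_preimage (X t)))).
Qed.

Lemma measurable_preimage d' (T' : measurableType d') (Y : {RV P >-> T'}) B :
  measurable B -> measurable (Y @^-1` B).
Proof.
by move=> mB; rewrite -[X in measurable X]setTI; exact: measurable_funPT.
Qed.

Lemma process_event_measurable A : process_event A -> measurable A.
Proof.
apply: smallest_sub; first exact: sigma_algebra_measurable.
by move=> _ [t _ [B _ <-]]; rewrite setTI; exact: measurable_preimage.
Qed.

Lemma measurable_path_event t x : measurable (path_event t x).
Proof. exact: process_event_measurable (process_event_path t x). Qed.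

Lemma filtration_measurable t A : filtration U X t A -> measurable A.
Proof.
apply: smallest_sub; first exact: sigma_algebra_measurable.
by move=> _ [[B mB <-]|[s _ [B _ <-]]]; rewrite setTI;
  exact: measurable_preimage.
Qed.

(** Once the path up to time [t] is known, the only information left in the
    filtration is about [U]. The events with this property form a sigma-algebra,
    so it is enough to check the generators. *)
Lemma filtration_trace t A : filtration U X t A -> forall x,
  exists2 B, measurable B &
    A `&` path_event t x = U @^-1` B `&` path_event t x.
Proof.
move=> FA x; move: A FA.
suff : filtration U X t `<=` [set A | exists2 B, measurable B &
    A `&` path_event t x = U @^-1` B `&` path_event t x] by [].
apply: smallest_sub; first split.
- by exists set0 => //; rewrite preimage_set0.
- move=> A [B mB AB]; exists (~` B); first exact: measurableC.
  rewrite setTD preimage_setC.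
  apply/seteqP; split=> w [Aw xw]; split => // Bw; apply: Aw.
    by have [] : (A `&` path_event t x) w by rewrite AB.
  by have [] : (U @^-1` B `&` path_event t x) w by rewrite -AB.
- move=> F FB'; have /choice[B mB] : forall i, exists B, measurable B /\
      F i `&` path_event t x = U @^-1` B `&` path_event t x.
    by move=> i; have [B mB FB] := FB' i; exists B.
  exists (\bigcup_i B i);
    first by apply: bigcupT_measurable => i; case: (mB i).
  rewrite preimage_bigcup !setI_bigcupl.
  by apply: eq_bigcupr => i _; case: (mB i).
- move=> _ [[B mB <-]|[s st [B _ <-]]]; first by exists B => //; rewrite setTI.
  have [Bx|Bx] := pselect (B (x s)).
    exists setT => //; rewrite preimage_setT !setTI; apply/setIidPr => w.
    by move=> /(_ s st) wx; rewrite /preimage/= wx.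
  exists set0 => //; rewrite preimage_set0 set0I setTI -subset0 => w [].
  by rewrite /preimage/= => + /(_ s st) wx; rewrite wx.
Qed.

Lemma pr_indep (B : set R) F : measurable B -> process_event F ->
  pr (U @^-1` B `&` F) = pr (U @^-1` B) * pr F.
Proof.
move=> mB mF; rewrite hUX// ?fineM//.
- by apply: fin_num_measure; exact: measurable_preimage.
- by apply: fin_num_measure; exact: process_event_measurable.
- by exists B => //; rewrite setTI.
Qed.

Lemma pr_path_step t x y :
  pr (path_event t x `&` X t.+1 @^-1` [set y]) =
  p (x t) y * pr (path_event t x).
Proof.
rewrite /path_event (markov_step hX) fineM//.
by apply: fin_num_measure; exact: measurable_path_event.
Qed.

(** The Markov property survives the extra randomness: on each history the event
    [A] only concerns [U], which is independent of the walk. *)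
Lemma markov_filtration t A x y : filtration U X t A ->
  pr (A `&` X t @^-1` [set x] `&` X t.+1 @^-1` [set y]) =
  p x y * pr (A `&` X t @^-1` [set x]).
Proof.
move=> FA; have mA := filtration_measurable FA.
have mX s z : measurable (X s @^-1` [set z]) by exact: measurable_preimage.
have mh h : measurable (history t @^-1` [set h]).
  by rewrite preimage_history; exact: measurable_path_event.
rewrite (probability_partition P mh)//; last by do 2?apply: measurableI.
rewrite [in RHS](probability_partition P mh)//; last exact: measurableI.
rewrite mulr_sumr; apply: eq_bigr => h _; rewrite preimage_history.
set E := path_event t _.
have [B mB AB] := filtration_trace FA (path_of h).
rewrite [in LHS]setIAC -[A `&` _ `&` E]setIA.
have [hx|hx] := eqVneq (path_of h t) x; last first.
  suff -> : X t @^-1` [set x] `&` E = set0.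
    by rewrite setI0 set0I measure0 mulr0.
  rewrite -subset0 => w [/= wx /(_ t (leqnn t))]; rewrite wx => /eqP.
  by rewrite eq_sym (negbTE hx).
have -> : X t @^-1` [set x] `&` E = E.
  by apply/setIidPr => w /(_ t (leqnn t)) /=; rewrite hx.
rewrite AB -setIA.
have hE : process_event E by exact: process_event_path.
rewrite !pr_indep//; last by apply: process_eventI => //; exact: process_eventX.
by rewrite pr_path_step hx mulrCA.
Qed.

Lemma probability_split A B : measurable A -> measurable B ->
  pr A = pr (A `&` B) + pr (A `\` B).
Proof.
move=> mA mB; rewrite -fineD; last 2 first.
- by apply: fin_num_measure; exact: measurableI.
- by apply: fin_num_measure; exact: measurableD.
congr fine; rewrite addeC; exact: measureDI.
Qed.

(** * From stopping times to flows *)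

Section StoppingTime.
Variable T : Omega -> option nat.
Hypothesis hT : stopping_time U X T.

Definition go_event t : set Omega :=
  [set w | ~ exists2 s : nat, (s <= t)%N & T w = Some s].
Definition stop_event t x : set Omega := [set w | T w = Some t /\ X t w = x].
Definition go_mass t x : R := pr (go_event t `&` X t @^-1` [set x]).
Definition stop_mass t x : R := pr (stop_event t x).

Lemma go_event_filtration t : filtration U X t (go_event t).
Proof.
rewrite (_ : go_event t =
    setT `\` [set w | exists2 s, (s <= t)%N & T w = Some s]).
  exact: sigma_algebraCD (@hT t).
by rewrite setTD.
Qed.

Let go_event_measurable t : measurable (go_event t).
Proof. exact: filtration_measurable (@go_event_filtration t). Qed.

Let mX t x : measurable (X t @^-1` [set x]).
Proof. exact: measurable_preimage. Qed.

Let stop_event0 x : stop_event 0 x = X 0%N @^-1` [set x] `\` go_event 0.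
Proof.
apply/seteqP; split => w /=.
  by move=> [T0 ?]; split => //; apply; exists 0%N.
by move=> [? /contrapT[s]]; rewrite leqn0 => /eqP ->.
Qed.

Let stop_eventS t x : stop_event t.+1 x =
  (go_event t `&` X t.+1 @^-1` [set x]) `\` go_event t.+1.
Proof.
apply/seteqP; split => w /=.
  move=> [Tw ?]; split; last by apply; exists t.+1.
  by split => // -[s]; rewrite Tw => + [ts]; rewrite -ts ltnn.
move=> [[goT ?] /contrapT[s]]; rewrite leq_eqVlt => /predU1P[->//|st Tw].
by exfalso; apply: goT; exists s.
Qed.

Let go_eventS t : go_event t.+1 `<=` go_event t.
Proof. by move=> w nT [s st Tw]; apply: nT; exists s => //; exact: leqW. Qed.

Lemma measurable_stop_event t x : measurable (stop_event t x).
Proof.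
case: t => [|t]; first by rewrite stop_event0; exact: measurableD.
by rewrite stop_eventS; apply: measurableD => //; exact: measurableI.
Qed.

Lemma stop_massE t x : stop_mass t x + go_mass t x =
  if t is s.+1 then pr (go_event s `&` X t @^-1` [set x])
  else pr (X 0%N @^-1` [set x]).
Proof.
rewrite addrC /stop_mass /go_mass; case: t => [|t].
  rewrite stop_event0.
  by rewrite (probability_split (mX 0 x) (go_event_measurable 0)) setIC.
rewrite stop_eventS [RHS](@probability_split _ (go_event t.+1))//;
  last exact: measurableI.
by rewrite setIAC (setIidr (@go_eventS t)).
Qed.

Lemma stopping_time_flow :
  stopping_flow p (fun x => fine (mu [set x])) stop_mass go_mass.
Proof.
split.
- by move=> t x; exact: fine_ge0.
- by move=> t x; exact: fine_ge0.
- by move=> x; rewrite stop_massE -(markov_init hX).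
- move=> t y; rewrite stop_massE (probability_partition P (mX t)); last first.
    exact: measurableI.
  apply: eq_bigr => x _.
  by rewrite setIAC (markov_filtration x y (@go_event_filtration t)) mulrC.
Qed.

Lemma cvg_stop_mass x : \sum_(s < t.+1) stop_mass s x @[t --> \oo] -->
  pr [set w | exists2 t, T w = Some t & X t w = x].
Proof.
rewrite (_ : [set w | _] = \bigcup_t stop_event t x); last first.
  by apply/seteqP; split => w /= [t]; [exists t|move=> _ []; exists t].
have mU : measurable (\bigcup_t stop_event t x).
  by apply: bigcupT_measurable => t; exact: measurable_stop_event.
rewrite (cvg_shiftS (fun t => \sum_(s < t) stop_mass s x)).
have : \sum_(0 <= s < t) P (stop_event s x) @[t --> \oo] -->
    (pr (\bigcup_t stop_event t x))%:E.
  rewrite fineK ?fin_num_measure//; apply: measure_semi_sigma_additive => //.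
    by move=> t; exact: measurable_stop_event.
  apply/trivIsetP => s t _ _ st; rewrite -subset0 => w [[Tws _] [Twt _]].
  by move: st; move: Tws; rewrite Twt => -[->]; rewrite eqxx.
move=> /fine_cvgP[_]; apply: cvg_trans; apply: near_eq_cvg; near=> t.
rewrite /= big_mkord -sum_fine// => s _.
by apply: fin_num_measure; exact: measurable_stop_event.
Unshelve. all: by end_near. Qed.

(** A time is the number of instants strictly before it. *)
Lemma expected_time :
  (\int[P]_w time_val R (T w) = \sum_(t <oo) (\sum_x go_mass t x)%:E)%E.
Proof.
transitivity (\int[P]_w \sum_(t <oo) (\1_(go_event t) w)%:E)%E.
  apply: eq_integral => w _; case Tw : (T w) => [k|]/=.
    rewrite (nneseries_split 0 k)//.
    rewrite add0n [X in (_ + X)%E]eseries0 => [|i ki _]; last first.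
      rewrite indicE memNset// => nT; apply: nT; exists k => //.
    rewrite adde0 big_mkord (eq_bigr (fun=> 1%E)) => [|i _]; last first.
      rewrite indicE mem_set// => -[s si]; rewrite Tw => -[ks].
      by move: si; rewrite -ks leqNgt ltn_ord.
    by rewrite sumEFin sumr_const card_ord.
  apply/esym/eq_infty => r; pose k := (Num.truncn r).+1.
  apply: (@le_trans _ _ k%:R%:E); first by rewrite lee_fin ltW// truncnS_gt.
  apply: le_trans (nneseries_lim_ge k _); last by move=> *; rewrite lee_fin.
  rewrite big_mkord (eq_bigr (fun=> 1%E)) => [|i _].
    by rewrite sumEFin sumr_const card_ord.
  by rewrite indicE mem_set// => -[s _]; rewrite Tw.
rewrite integral_nneseries//.
- apply: eq_eseriesr => t _; rewrite integral_indic// setIT.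
  by rewrite /go_mass -probability_partition// fineK// fin_num_measure.
- by move=> t; apply/measurable_EFinP; exact: measurable_indic.
Qed.

End StoppingTime.

(** * From flows to stopping times *)

Section Realization.
Hypothesis hU : uniform01 U.
Variables m g : nat -> 'I_n.+1 -> R.
Hypothesis mgF : stopping_flow p (fun x => fine (mu [set x])) m g.

Lemma pr_uniform_lt (c : R) : 0 <= c <= 1 -> pr (U @^-1` `]-oo, c[) = c.
Proof.
move=> /andP[c0 c1]; rewrite -[P _]/(distribution P U `]-oo, c[).
rewrite hU//; rewrite /uniform_prob integral_uniform_pdf.
have -> : `]-oo, c[ `&` `[0, 1] = `[0, c[%classic.
  apply/seteqP; split => r /=; rewrite !in_itv/=.
    by move=> [-> /andP[->]].
  by move=> /andP[-> rc]; split => //; rewrite ltW// (lt_le_trans rc).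
rewrite (eq_integral (cst 1%E)); last first.
  move=> r; rewrite inE/= in_itv/= /uniform_pdf => /andP[-> rc].
  by rewrite ltW ?(lt_le_trans rc)// subr0 invr1.
rewrite integral_cst//= mul1e lebesgue_measure_itv/= lte_fin.
case: ltP => [_|c0']; rewrite ?oppr0 ?adde0//=.
by apply/esym/eqP; rewrite eq_le c0 c0'.
Qed.

(** The conditional probability of going on at time [t] in state [x]. In a state
    carrying no mass the quotient is [0], which is harmless. *)
Definition go_prob t x : R := g t x / (m t x + g t x).

Let m_ge0 t x : 0 <= m t x. Proof. exact: flow_stop_ge0 mgF t x. Qed.
Let g_ge0 t x : 0 <= g t x. Proof. exact: flow_go_ge0 mgF t x. Qed.

Lemma go_prob01 t x : 0 <= go_prob t x <= 1.
Proof.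
rewrite /go_prob divr_ge0 ?addr_ge0//=.
have [->|mg0] := eqVneq (m t x + g t x) 0.
  by rewrite invr0 mulr0.
by rewrite ler_pdivrMr ?mul1r ?lerDr// lt_def mg0 addr_ge0.
Qed.

Lemma go_probK t x : go_prob t x * (m t x + g t x) = g t x.
Proof.
have [mg0|mg0] := eqVneq (m t x + g t x) 0; last by rewrite divfK.
rewrite mg0 mulr0; apply/esym/eqP; move: mg0 => /eqP.
by rewrite paddr_eq0// => /andP[].
Qed.

(** The probability of surviving all the decisions taken before time [t] along
    the path [x], if these are independent. *)
Definition survival t (x : nat -> 'I_n.+1) : R := \prod_(s < t) go_prob s (x s).

Lemma survival01 t x : 0 <= survival t x <= 1.
Proof.
rewrite prodr_ge0 ?prodr_ile1//= => [s _|s _]; first exact: go_prob01.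
by case/andP: (go_prob01 s (x s)).
Qed.

Lemma eq_survival t x y : (forall s, (s <= t)%N -> x s = y s) ->
  survival t x = survival t y.
Proof. by move=> xy; apply: eq_bigr => s _; rewrite xy// ltnW. Qed.

(** A single uniform variable serves for all the decisions: rather than drawing
    afresh at each step, compare [U] with the decreasing survival probability. *)
Definition alive t : set Omega := [set w | U w < survival t (X ^~ w)].

(** A threshold determined by the past takes finitely many values, one for each
    history. *)
Lemma below_threshold_filtration t (f : (nat -> 'I_n.+1) -> R) :
  (forall x y, (forall s, (s <= t)%N -> x s = y s) -> f x = f y) ->
  filtration U X t [set w | U w < f (X ^~ w)].
Proof.
move=> eq_f; pose I := {ffun 'I_t.+1 -> 'I_n.+1}.
rewrite (_ : [set w | _] = \big[setU/set0]_(h <- index_enum I)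
    (U @^-1` `]-oo, f (path_of h)[ `&` path_event t (path_of h))).
  rewrite /filtration; set G := (X in <<s X >>).
  apply: (@bigsetU_measurable _ (g_sigma_algebraType G)) => h _.
  apply: (@measurableI _ (g_sigma_algebraType G)).
    apply: sub_sigma_algebra; left.
    by exists `]-oo, f (path_of h)[%classic; rewrite ?setTI.
  apply: sigma_algebra_path_event => s st; apply: sub_sigma_algebra; right.
  by exists s => //; exists [set path_of h s]; rewrite ?setTI.
rewrite -bigcup_seq; apply/seteqP; split => w /=.
  move=> Uw; exists (history t w); first exact: mem_index_enum.
  have Ew : path_event t (path_of (history t w)) w by rewrite -preimage_history.
  by split => //=; rewrite in_itv/= -(eq_f _ _ Ew).
by move=> [h _ [/= + Ew]]; rewrite in_itv/= (eq_f _ _ Ew).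
Qed.

Lemma alive_filtration t : filtration U X t (alive t.+1).
Proof.
apply: below_threshold_filtration => x y xy.
by apply: eq_bigr => s _; rewrite xy// -ltnS.
Qed.

(** On each history the threshold is constant, and [U] falls below a constant [c]
    with probability [c], independently of the walk. *)
Lemma pr_thinned_alive t k F : process_event F -> 0 <= k <= 1 ->
  pr ([set w | U w < survival t (X ^~ w) * k] `&` F) = k * pr (alive t `&` F).
Proof.
move=> pF k01.
have mh h : measurable (history t @^-1` [set h]).
  by rewrite preimage_history; exact: measurable_path_event.
have pE (l : R) h : 0 <= l <= 1 ->
    pr ([set w | U w < survival t (X ^~ w) * l] `&` F
        `&` history t @^-1` [set h]) =
    survival t (path_of h) * l * pr (F `&` history t @^-1` [set h]).
  move=> /andP[l0 l1]; rewrite preimage_history; set E := path_event t _.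
  rewrite (_ : [set w | _] `&` F `&` E =
      U @^-1` `]-oo, survival t (path_of h) * l[ `&` (F `&` E)).
    rewrite pr_indep//;
      last by apply: process_eventI => //; exact: process_event_path.
    rewrite pr_uniform_lt//; have /andP[s0 s1] := survival01 t (path_of h).
    by rewrite mulr_ge0//= mulr_ile1.
  rewrite -setIA; apply/seteqP; split => w /= [+ [Fw Ew]];
    by rewrite in_itv/= (eq_survival Ew).
have mk (l : R) : measurable [set w | U w < survival t (X ^~ w) * l].
  apply: (@filtration_measurable t).
  apply: (below_threshold_filtration (f := fun x => survival t x * l)).
  by move=> x y /eq_survival ->.
have ma : alive t = [set w | U w < survival t (X ^~ w) * 1].
  by under [in RHS]eq_set do rewrite mulr1.
rewrite (probability_partition P mh); last first.
  by apply: measurableI => //; exact: process_event_measurable.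
rewrite ma [in RHS](probability_partition P mh); last first.
  by apply: measurableI => //; exact: process_event_measurable.
rewrite mulr_sumr; apply: eq_bigr => h _.
by rewrite !pE ?ler01 ?lexx//; ring.
Qed.

Definition realizing_time (w : Omega) : option nat :=
  if pselect (exists t, ~~ (U w < survival t.+1 (X ^~ w))) is left ex_t
  then Some (ex_minn ex_t) else None.

Lemma alive_nonincreasing t : alive t.+1 `<=` alive t.
Proof.
move=> w; rewrite /alive/= => /lt_le_trans; apply.
rewrite /survival big_ord_recr/=; have /andP[g0 g1] := go_prob01 t (X t w).
by rewrite ler_piMr//; case/andP: (survival01 t (X^~ w)).
Qed.

Lemma go_event_realizing_time t : go_event realizing_time t = alive t.+1.
Proof.
apply/seteqP; split => w; rewrite /go_event /alive/= /realizing_time.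
  case: pselect => [ex_t nT|nT _].
    case: ex_minnP nT => k _ kmin nT; apply/negPn/negP => Ut; apply: nT.
    by exists k => //; exact: kmin.
  by apply/negPn/negP => Ut; apply: nT; exists t.
move=> Ut [s st]; case: pselect => // ex_t [].
case: ex_minnP => k /negP Uk _ ks; apply: Uk; rewrite ks => {ks ex_t k}.
move: Ut; suff : alive t.+1 `<=` alive s.+1 by apply.
elim: t st => [|t IHt]; first by rewrite leqn0 => /eqP ->.
rewrite leq_eqVlt => /predU1P[->//|st].
by apply: subset_trans (IHt st); exact: alive_nonincreasing.
Qed.

Lemma realizing_time_stopping : stopping_time U X realizing_time.
Proof.
move=> t; rewrite (_ : [set w | _] = setT `\` alive t.+1).
  exact: sigma_algebraCD (@alive_filtration t).
by rewrite -go_event_realizing_time setTD -[LHS]setCK.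
Qed.

Let pr_alive0 F : process_event F -> pr (alive 0 `&` F) = pr F.
Proof.
move=> pF; rewrite (_ : alive 0 = U @^-1` `]-oo, 1[).
  by rewrite pr_indep// pr_uniform_lt ?ler01 ?lexx// mul1r.
by apply/seteqP; split => w; rewrite /alive /survival/= in_itv/= big_ord0.
Qed.

Let pr_aliveS t x : pr (alive t `&` X t @^-1` [set x]) = m t x + g t x ->
  go_mass realizing_time t x = g t x.
Proof.
move=> aE; rewrite /go_mass go_event_realizing_time.
rewrite -[RHS]go_probK -aE -pr_thinned_alive ?go_prob01//;
  last exact: process_eventX.
congr (pr _); apply/seteqP; split => w;
  rewrite /alive/survival/= big_ord_recr/=;
  by move=> [Uw xE]; move: Uw; rewrite xE.
Qed.

(** The mass arriving at time [t] is propagated by the Markov property, then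
    thinned by [go_prob], which is the recursion defining a flow. *)
Lemma realizing_time_go t x : go_mass realizing_time t x = g t x.
Proof.
elim: t x => [|t IHt] x; apply: pr_aliveS.
  rewrite (flow_init mgF) -(markov_init hX) pr_alive0//.
  exact: process_eventX.
rewrite (flow_step mgF) (probability_partition P (Y := X t)); last 2 first.
- by move=> y; exact: measurable_preimage.
- apply: measurableI; last exact: measurable_preimage.
  exact: filtration_measurable (@alive_filtration t).
apply: eq_bigr => y _.
rewrite setIAC (markov_filtration y x (@alive_filtration t)).
by rewrite -go_event_realizing_time mulrC -[pr _]/(go_mass _ _ _) IHt.
Qed.

(** Both flows satisfy the same conservation law with the same moving mass. *)
Lemma realizing_time_stop t x : stop_mass realizing_time t x = m t x.
Proof.
have TF := stopping_time_flow realizing_time_stopping.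
apply: (@addIr _ (g t x)); rewrite -{1}realizing_time_go.
case: t => [|t]; first by rewrite (flow_init TF) (flow_init mgF).
rewrite (flow_step TF) (flow_step mgF).
by under eq_bigr do rewrite realizing_time_go.
Qed.

End Realization.

(** * The optimal transport time *)

Section Transport.
Variable nu : probability 'I_n.+1 R.

(** Almost sure finiteness follows from the law at the stopping time: all the
    mass of a probability gets stopped. *)
Lemma transports_of_stop_mass T : stopping_time U X T ->
  (forall x,
    \sum_(s < t.+1) stop_mass T s x @[t --> \oo] --> fine (nu [set x])) ->
  transports U X nu T.
Proof.
move=> hT Tnu; pose W x := [set w | exists2 t, T w = Some t & X t w = x].
have mW x : measurable (W x).
  rewrite (_ : W x = \bigcup_t stop_event T t x).
    by apply: bigcupT_measurable => t; exact: measurable_stop_event.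
  by apply/seteqP; split => w /= [t]; [exists t|move=> _ []; exists t].
have PW x : P (W x) = nu [set x].
  rewrite -[LHS]fineK ?fin_num_measure// -[RHS]fineK ?fin_num_measure//.
  congr (_%:E); rewrite -(cvg_lim _ (Tnu x))//; apply/esym/cvg_lim => //.
  exact: cvg_stop_mass.
have law A : P [set w | exists2 t : nat, T w = Some t & A (X t w)] = nu A.
  have finA : finite_set A by exact: finite_finset.
  rewrite (_ : [set w | _] = \bigcup_(x in A) W x); last first.
    apply/seteqP; split => w /=.
      by move=> [t Tt At]; exists (X t w) => //; exists t.
    by move=> [x Ax [t Tt Xt]]; exists t; rewrite ?Xt.
  have AE : A = \bigcup_(x in A) [set x].
    by apply/seteqP; split => [x Ax|x [_ Ay ->]//]; exists x.
  rewrite [in RHS]AE.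
  rewrite !measure_fin_bigcup//.
  - by apply: eq_fsbigr => x _; exact: PW.
  - exact: trivIset_set1.
  - apply/trivIsetP => x y _ _ xy.
    apply/seteqP; split => // w [[t Tt Xt] [s Ts Xs]].
    by move: xy; move: Ts; rewrite Tt -Xt -Xs => -[->]; rewrite eqxx.
split => //.
pose stopped := [set w | exists2 t : nat, T w = Some t & setT (X t w)].
have mstopped : measurable stopped.
  rewrite (_ : stopped = \big[setU/set0]_(x <- index_enum 'I_n.+1) W x).
    exact: bigsetU_measurable.
  rewrite -bigcup_seq; apply/seteqP; split => w /=.
    by move=> [t Tt _]; exists (X t w); [exact: mem_index_enum|exists t].
  by move=> [x _ [t Tt _]]; exists t.
exists (~` stopped); split; first exact: measurableC.
  by rewrite probability_setC// law probability_setT subee.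
by move=> w /= /contrapT Tw [t Tt _]; rewrite Tw in Tt.
Qed.

End Transport.
End Walk.

Section PathTransport.
Context (R : realType) (n : nat) (n_gt0 : (0 < n)%N)
  (mu nu : probability 'I_n.+1 R)
  (d : measure_display) (Omega : measurableType d) (P : probability Omega R)
  (U : {RV P >-> R}) (X : nat -> {RV P >-> 'I_n.+1}).
Hypothesis hX : markov_chain (@path_walk R n) mu X.
Hypothesis hUX : independent_of_process U X.

Let gap j :=
  hitting_gap (fun x => fine (mu [set x])) (fun x => fine (nu [set x])) j.

Let mass_eq : \sum_x fine (mu [set x]) = \sum_x fine (nu [set x]).
Proof. by rewrite !sum_probability_ord. Qed.

Lemma hitting_gap_le_time T : transports U X nu T ->
  forall j, ((gap j)%:E <= \int[P]_w time_val R (T w))%E.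
Proof.
move=> [hT _ lawT] j; rewrite (expected_time hT).
set S := (X in (_ <= X)%E).
have S0 : (0 <= S)%E.
  apply: nneseries_ge0 => t _ _.
  by rewrite lee_fin sumr_ge0// => x _; exact: fine_ge0.
have partialS t : ((\sum_(s < t) \sum_x go_mass X T s x)%:E <= S)%E.
  rewrite -sumEFin -(big_mkord xpredT (fun s => (\sum_x go_mass X T s x)%:E)).
  rewrite /S; apply: nneseries_lim_ge => s _ _.
  by rewrite lee_fin sumr_ge0// => x _; exact: fine_ge0.
case: S S0 partialS => [B _ partialS|_ _|//]; last exact: leey.
rewrite lee_fin.
have TF := stopping_time_flow hX hUX hT.
apply: (hitting_gap_le_flow_time n_gt0 TF mass_eq) => // x.
by rewrite -lawT; exact: cvg_stop_mass.
Qed.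

(** The bound is reached by the stopping time that realizes the filling rule. *)
Lemma transport_attained : uniform01 U -> exists2 T, transports U X nu T &
  exists j, (\int[P]_w time_val R (T w) <= (gap j)%:E)%E.
Proof.
move=> hU; set mu' := fun x => fine (mu [set x]).
set nu' := fun x => fine (nu [set x]).
have mu0 x : 0 <= mu' x by exact: fine_ge0.
have nu0 x : 0 <= nu' x by exact: fine_ge0.
have mu1 : \sum_x mu' x = 1 by exact: sum_probability_ord.
have nu1 : \sum_x nu' x = 1 by exact: sum_probability_ord.
have fillF := filling_flow mu0 nu0.
have hT : stopping_time U X
    (realizing_time U X (filling_stop mu' nu') (filling_go mu' nu')).
  exact: realizing_time_stopping fillF.
eexists; first apply: (transports_of_stop_mass hT) => x.
  under eq_cvg do under eq_bigr do
    rewrite (realizing_time_stop hX hUX hU fillF).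
  exact: (cvg_filling_stop n_gt0).
have [j gapj] := filling_time_le n_gt0 mu0 nu0 mu1 nu1; exists j.
rewrite (expected_time hT); apply: lime_le.
  apply: is_cvg_nneseries => t _ _.
  by rewrite lee_fin sumr_ge0// => x _; exact: fine_ge0.
near=> t; rewrite big_mkord sumEFin lee_fin.
under eq_bigr do under eq_bigr do rewrite (realizing_time_go hX hUX hU fillF).
exact: gapj.
Unshelve. all: by end_near. Qed.

End PathTransport.

Section Main.
Context (R : realType) (n : nat) (mu nu : probability 'I_n.+1 R).
Local Open Scope ereal_scope.

Let gap j : R :=
  hitting_gap (fun x => fine (mu [set x])) (fun x => fine (nu [set x])) j.

Lemma hitting_gapE (j : 'I_n.+1) :
  (gap j)%:E = 'E_nu[fun z => (z%:R ^+ 2)%R] - 'E_mu[fun z => (z%:R ^+ 2)%R]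
    + (2 * n%:R)%R%:E * ('E_mu[fun z => (Num.max (z%:R - j%:R) 0)%R]
                         - 'E_nu[fun z => (Num.max (z%:R - j%:R) 0)%R]).
Proof.
rewrite !expectation_ord -!EFinB -EFinM -EFinD; congr (_%:E).
rewrite -!sumrB mulr_sumr -big_split/=; apply: eq_bigr => x _.
by rewrite /potential; ring.
Qed.

Lemma affine_bigmaxe (c k : \bar R) (e : 'I_n.+1 -> \bar R) : 0 <= k ->
  c + k * \big[maxe/-oo]_(j < n.+1) e j =
  \big[maxe/-oo]_(j < n.+1) (c + k * e j).
Proof.
move=> k0.
have [j _ ej] := @eq_bigmax _ _ _ -oo ord0 xpredT e isT (fun i _ => leNye _).
apply/eqP; rewrite eq_le; apply/andP; split.
  by rewrite ej; exact: (le_bigmax _ (fun j => c + k * e j)).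
apply/bigmax_leP; split => [|i _]; first exact: leNye.
by rewrite leeD2l// lee_wpmul2l ?le_bigmax.
Qed.

Lemma max_hitting_gap :
  'E_nu[fun z => (z%:R ^+ 2)%R] - 'E_mu[fun z => (z%:R ^+ 2)%R]
    + (2 * n%:R)%R%:E *
      \big[maxe/-oo]_(j < n.+1)
        ('E_mu[fun z => (Num.max (z%:R - j%:R) 0)%R]
         - 'E_nu[fun z => (Num.max (z%:R - j%:R) 0)%R])
  = \big[maxe/-oo]_(j < n.+1) (gap j)%:E.
Proof.
rewrite affine_bigmaxe ?lee_fin ?mulr_ge0//; apply: eq_bigr => j _.
by rewrite hitting_gapE.
Qed.

End Main.

Local Open Scope ereal_scope.

Theorem theorem2p4 (R : realType) (n : nat) (hn : (1 <= n)%N)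
    (mu nu : probability 'I_n.+1 R)
    (d : measure_display) (Omega : measurableType d) (P : probability Omega R)
    (U : {RV P >-> R}) (X : nat -> {RV P >-> 'I_n.+1})
    (hX : markov_chain (@path_walk R n) mu X)
    (hU : uniform01 U) (hUX : independent_of_process U X) :
  [/\ transport_time U X nu =
        'E_nu[fun z => (z%:R ^+ 2)%R] - 'E_mu[fun z => (z%:R ^+ 2)%R]
        + (2 * n%:R)%R%:E *
          \big[maxe/-oo]_(j < n.+1)
            ('E_mu[fun z => (Num.max (z%:R - j%:R) 0)%R]
             - 'E_nu[fun z => (Num.max (z%:R - j%:R) 0)%R]),
      maxe ('E_nu[fun z => (z%:R ^+ 2)%R] - 'E_mu[fun z => (z%:R ^+ 2)%R]
            + (2 * n%:R)%R%:E *
              ('E_mu[fun z => z%:R%R] - 'E_nu[fun z => z%:R%R])) 0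
        <= transport_time U X nu
    & transport_time U X nu <= (n%:R ^+ 2)%R%:E].
Proof.
pose gap j :=
  hitting_gap (fun x => fine (mu [set x])) (fun x => fine (nu [set x])) j.
have le_gap j : (gap j)%:E <= \big[maxe/-oo]_(i < n.+1) (gap i)%:E.
  exact: (le_bigmax _ (fun i => (gap i)%:E)).
have timeE : transport_time U X nu = \big[maxe/-oo]_(j < n.+1) (gap j)%:E.
  apply/eqP; rewrite eq_le; apply/andP; split.
    have [T hT [j Tj]] := transport_attained hn nu hX hUX hU.
    apply: le_trans (le_gap j); apply: (le_trans _ Tj).
    by apply: ereal_inf_lbound; exists T.
  apply: le_ereal_inf_tmp => _ [T hT <-].
  apply/bigmax_leP; split => [|j _]; first exact: leNye.
  exact: (hitting_gap_le_time hn hX hUX hT).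
split; first by rewrite timeE max_hitting_gap.
- rewrite ge_max; apply/andP; split.
    (* the mean is the mean of (Z - 0)_+, so this is the term j = 0 *)
    have -> : (fun z : 'I_n.+1 => z%:R : R)%R
        = (fun z : 'I_n.+1 => Num.max (z%:R - (ord0 : 'I_n.+1)%:R) 0)%R.
      by apply/funext => z; rewrite subr0 max_l.
    by rewrite timeE -hitting_gapE; exact: le_gap.
  apply: le_ereal_inf_tmp => _ [T hT <-]; apply: integral_ge0 => w _.
  by case: (T w) => [t|] /=; rewrite ?lee_fin// leey.
- rewrite timeE; apply/bigmax_leP; split => [|j _]; first exact: leNye.
  rewrite lee_fin hitting_gap_le ?sum_probability_ord// => x; exact: fine_ge0.
Qed.
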